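(* Let $1\le s\le n$ and $0<\gamma<1$. Let $\boldsymbol{\Phi}\in\mathbb{R}^{m\times d}$ have rows drawn i.i.d. from $N(\mathbf{0},\boldsymbol{\Sigma})$, where the positive definite covariance $\boldsymbol{\Sigma}$ has smallest and largest singular values $\sigma_{\min}^2,\sigma_{\max}^2$ and condition number $\kappa=\sigma_{\max}^2/\sigma_{\min}^2$. Let $\mathbf{D}=[\mathbf{d}_1,\dots,\mathbf{d}_n]\in\mathbb{R}^{d\times n}$ satisfy $\inf\{\|\mathbf{D}\mathbf{x}\|_2:\mathbf{x}\in S_\gamma\}\ge\eta$ for some $\eta>0$ and $\max_i\|\mathbf{d}_i\|_2^2\le\rho$. If \[ m\ \ge\ \frac{18\cdot 2^9\pi e}{\eta^2}\,\frac{\rho\kappa}{\gamma^2}\,s\log(2n), \] then with probability at least $1-\exp\!\left(-\frac{m}{128e\pi}\right)$, the matrix $\boldsymbol{\Phi}\mathbf{D}$ has the null space property of order $s$.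
   Context: For $\mathbf{x}\in\mathbb{R}^n$ and $T\subset[n]$, $\mathbf{x}_T$ agrees with $\mathbf{x}$ on $T$ and is $0$ elsewhere, $T^c=[n]\setminus T$. $S_\gamma:=\{\mathbf{x}\in\mathbb{R}^n:\|\mathbf{x}\|_2=1,\ \|\mathbf{x}_T\|_1\ge\gamma\|\mathbf{x}_{T^c}\|_1\text{ for some }|T|\le s\}$. A matrix $\mathbf{A}$ with $n$ columns has the null space property of order $s$ if $\|\mathbf{x}_T\|_1<\|\mathbf{x}_{T^c}\|_1$ for every $\mathbf{x}\in\ker\mathbf{A}\setminus\{0\}$ and every $T\subset[n]$ with $|T|\le s$. *)

(* Defs.v *)
From HB Require Import structures.
From mathcomp Require Import all_boot all_order all_algebra.
From mathcomp Require Import all_classical all_reals all_analysis.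
Set Implicit Arguments. Unset Strict Implicit. Unset Printing Implicit Defensive.
Import Order.TTheory GRing.Theory Num.Theory.
Local Open Scope classical_set_scope.
Local Open Scope ring_scope.

Section Defs.
Context {R : realType}.

Definition restr n (x : 'cV[R]_n) (T : {set 'I_n}) : 'cV[R]_n :=
  \col_i (if i \in T then x i 0 else 0).

Definition norm1 n (x : 'cV[R]_n) : R := \sum_i `|x i 0|.
Definition norm2 n (x : 'cV[R]_n) : R := Num.sqrt (\sum_i (x i 0) ^+ 2).

Definition S_gamma n (s : nat) (gamma : R) : set 'cV[R]_n :=
  [set x | norm2 x = 1 /\
     exists T : {set 'I_n}, (#|T| <= s)%N /\
       gamma * norm1 (restr x (~: T)) <= norm1 (restr x T)].

Definition NSP m n (A : 'M[R]_(m, n)) (s : nat) : Prop :=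
  forall x : 'cV[R]_n, A *m x = 0 -> x != 0 ->
  forall T : {set 'I_n}, (#|T| <= s)%N ->
    norm1 (restr x T) < norm1 (restr x (~: T)).

Definition singular_value d (A : 'M[R]_d) (sv : R) : Prop :=
  0 <= sv /\ eigenvalue (A^T *m A) (sv ^+ 2).

Definition pos_def d (S : 'M[R]_d) : Prop :=
  S^T = S /\ forall x : 'rV[R]_d, x != 0 -> 0 < (x *m S *m x^T) 0 0.

Definition rand_mx m d T (X : 'I_m -> 'I_d -> T -> R) (w : T) : 'M[R]_(m, d) :=
  \matrix_(i, j) X i j w.

Definition gaussian_row m d dT (T : measurableType dT) (P : probability T R)
  (X : 'I_m -> 'I_d -> T -> R) (S : 'M[R]_d) (i : 'I_m) : Prop :=
  forall a : 'rV[R]_d, a != 0 -> forall B : set R, measurable B ->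
    P ((fun w => \sum_j a 0 j * X i j w) @^-1` B) =
    normal_prob 0 (Num.sqrt ((a *m S *m a^T) 0 0)) B.

(* the rows of X are mutually independent random vectors (product rule on
   the generating pi-systems of measurable rectangles) *)
Definition indep_rows m d dT (T : measurableType dT) (P : probability T R)
  (X : 'I_m -> 'I_d -> T -> R) : Prop :=
  forall A : 'I_m -> 'I_d -> set R, (forall i j, measurable (A i j)) ->
    P (\bigcap_(i in [set: 'I_m]) \bigcap_(j in [set: 'I_d]) (X i j @^-1` A i j)) =
    (\prod_(i < m) P (\bigcap_(j in [set: 'I_d]) (X i j @^-1` A i j)))%E.

End Defs.

(* Main.v *)
Require Import Defs.
From HB Require Import structures.
From mathcomp Require Import all_boot all_order all_algebra.
From mathcomp Require Import all_classical all_reals all_analysis.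
From mathcomp Require Import measurable_realfun ring lra.
Import Order.TTheory GRing.Theory Num.Theory.
Import numFieldNormedType.Exports.
Local Open Scope classical_set_scope.
Local Open Scope ring_scope.

(* A nonzero kernel vector violating the null space property lies in the cone
   of [S_gamma]; normalise it to l1-norm 1, so that |D x|_2 is at least
   eta / (2 sqrt s).  Maurey's sampling argument replaces k x by a signed sum y
   of k unit vectors such that D (y - k x) and Phi D (y - k x) = Phi D y are
   both small, the latter because every |Phi d_i|_2 is at most
   2 sqrt (m rho) sigma_max.  For k of order rho kappa s / eta^2 this forces
   |D y|_2 to be large and |Phi D y|_2 to be abnormally small.  Both the failure
   of |Phi d_i|_2 to be bounded and the smallness of |Phi D y|_2 are
   exponentially unlikely by Chernoff bounds for Gaussian squares, and there
   are only n + (2n)^k events to sum over. *)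

(** * Sparse approximation in the l1-ball *)

Section SquaredNorm.
Set Implicit Arguments.
Unset Strict Implicit.
Context {R : realType}.

Definition sqnorm n (v : 'cV[R]_n) : R := \sum_i (v i 0) ^+ 2.

Lemma sqnorm_ge0 n (v : 'cV[R]_n) : 0 <= sqnorm v.
Proof. by apply: sumr_ge0 => i _; exact: sqr_ge0. Qed.

Lemma sqr_norm2 n (v : 'cV[R]_n) : norm2 v ^+ 2 = sqnorm v.
Proof. by rewrite sqr_sqrtr// sqnorm_ge0. Qed.

Lemma sqnorm0 n : sqnorm (0 : 'cV[R]_n) = 0.
Proof. by apply: big1 => i _; rewrite mxE expr0n. Qed.

Lemma sqnorm_eq0 n (v : 'cV[R]_n) : (sqnorm v == 0) = (v == 0).
Proof.
apply/idP/eqP => [|->]; last by rewrite sqnorm0.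
rewrite psumr_eq0 => [/allP v0|i _]; last exact: sqr_ge0.
apply/colP => i; rewrite mxE; apply/eqP.
by rewrite -sqrf_eq0 (implyP (v0 i (mem_index_enum i))).
Qed.

Lemma sqnorm_gt0 n (v : 'cV[R]_n) : (0 < sqnorm v) = (v != 0).
Proof. by rewrite lt0r sqnorm_ge0 andbT sqnorm_eq0. Qed.

Lemma sqnormZ n (c : R) (v : 'cV[R]_n) : sqnorm (c *: v) = c ^+ 2 * sqnorm v.
Proof.
by rewrite /sqnorm mulr_sumr; apply: eq_bigr => i _; rewrite mxE exprMn.
Qed.

Lemma sqnormB_le n (u v : 'cV[R]_n) :
  sqnorm (u - v) <= 2 * sqnorm u + 2 * sqnorm v.
Proof.
rewrite /sqnorm !mulr_sumr -big_split; apply: ler_sum => i _ /=.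
by rewrite !mxE; have := sqr_ge0 (u i 0 + v i 0); nra.
Qed.

Lemma sqnorm_col_mx m n (u : 'cV[R]_m) (v : 'cV[R]_n) :
  sqnorm (col_mx u v) = sqnorm u + sqnorm v.
Proof.
rewrite /sqnorm big_split_ord /=.
by congr (_ + _); apply: eq_bigr => i _; rewrite ?col_mxEu ?col_mxEd.
Qed.

(* Maurey's argument, derandomised: if [u] is the current deviation and [j] is
   drawn with law [p], the deviation [u + (v j - x)] has mean square
   [sqnorm u + sum_j p_j sqnorm (v j) - sqnorm x], so some [j] adds at
   most [B]. *)
Lemma maurey n (J : finType) (p : J -> R) (v : J -> 'cV[R]_n) (B : R) (k : nat) :
  (forall j, 0 <= p j) -> \sum_j p j = 1 -> (forall j, sqnorm (v j) <= B) ->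
  exists t : k.-tuple J,
    sqnorm (\sum_(j <- t) v j - k%:R *: \sum_j p j *: v j) <= k%:R * B.
Proof.
move=> p0 p1 vB; set x := \sum_j p j *: v j.
(* Greedy step: if every [j] overshot, the [p]-average of the overshoots would be nonnegative, while
   the identity [avg] bounds it above by [- sqnorm x]. *)
have mean u : exists j, sqnorm (u + (v j - x)) <= sqnorm u + B.
  apply/existsP; apply: contraT => /existsPn no.
  have gap j : 0 < sqnorm (u + (v j - x)) - (sqnorm u + B).
    by rewrite subr_gt0 ltNge; exact: no.
  have nonneg j : true -> 0 <= p j * (sqnorm (u + (v j - x)) - (sqnorm u + B)).
    by move=> _; rewrite mulr_ge0 ?p0// ltW.
  have avg : \sum_j p j * sqnorm (u + (v j - x)) =
      sqnorm u - sqnorm x + \sum_j p j * sqnorm (v j).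
    rewrite /sqnorm -sumrB.
    under eq_bigr do rewrite mulr_sumr.
    under [X in _ = _ + X]eq_bigr do rewrite mulr_sumr.
    rewrite exchange_big [X in _ = _ + X]exchange_big /= -big_split.
    apply: eq_bigr => i _.
    have xi : x i 0 = \sum_j p j * v j i 0.
      by rewrite summxE; apply: eq_bigr => j _; rewrite mxE.
    transitivity (\sum_j ((u i 0 - x i 0) ^+ 2 * p j
        + 2 * (u i 0 - x i 0) * (p j * v j i 0) + p j * v j i 0 ^+ 2)).
      by apply: eq_bigr => j _; rewrite !mxE; ring.
    by rewrite !big_split /= -!mulr_sumr p1 -xi; ring.
  have : \sum_j p j * (sqnorm (u + (v j - x)) - (sqnorm u + B)) <= 0.
    under eq_bigr do rewrite mulrBr.
    rewrite sumrB avg -mulr_suml p1 mul1r.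
    have : \sum_j p j * sqnorm (v j) <= B.
      rewrite -[B]mul1r -p1 mulr_suml; apply: ler_sum => j _.
      by rewrite ler_wpM2l.
    by have := sqnorm_ge0 x; lra.
  (* A sum of nonnegative terms that is at most 0 has all terms 0; since each [gap j] is positive,
     every [p j] vanishes, against [p1]. *)
  rewrite le_eqVlt ltNge sumr_ge0// orbF psumr_eq0// => /allP allz.
  suff: \sum_j p j = 0 by rewrite p1 => /eqP; rewrite oner_eq0.
  apply: big1 => j _; apply/eqP; have := allz j (mem_index_enum j).
  by rewrite mulf_eq0 (gt_eqF (gap j)) orbF.
elim: k => [|k [t IH]].
  by exists [tuple]; rewrite big_nil scale0r subr0 sqnorm0 mul0r.
have [j jP] := mean (\sum_(j <- t) v j - k%:R *: x).
exists [tuple of j :: t]; rewrite /= big_cons.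
have -> : v j + \sum_(j <- t) v j - k.+1%:R *: x =
    \sum_(j <- t) v j - k%:R *: x + (v j - x).
  by rewrite -natr1 scalerDl scale1r opprD; apply/colP => i; rewrite !mxE; ring.
by rewrite -natr1 mulrDl mul1r (le_trans jP)// lerD2r.
Qed.

End SquaredNorm.

Section SparseApproximation.
Set Implicit Arguments.
Unset Strict Implicit.
Context {R : realType}.

(** Cauchy-Schwarz against the all-ones vector. The nonnegative sum of [(N * a i - S) ^+ 2] is [N]
    times the difference of the two sides, so [N = 0] is treated apart. *)
Lemma sqr_sum_le (I : finType) (A : {set I}) (a : I -> R) :
  (\sum_(i in A) a i) ^+ 2 <= #|A|%:R * \sum_(i in A) a i ^+ 2.
Proof.
set S := \sum_(i in A) a i; set N : R := #|A|%:R.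
have : 0 <= \sum_(i in A) (N * a i - S) ^+ 2.
  by apply: sumr_ge0 => i _; exact: sqr_ge0.
have -> : \sum_(i in A) (N * a i - S) ^+ 2 =
    N * (N * (\sum_(i in A) a i ^+ 2) - S ^+ 2).
  transitivity (\sum_(i in A) (N ^+ 2 * a i ^+ 2 - 2 * N * S * a i + S ^+ 2)).
    by apply: eq_bigr => i _; ring.
  rewrite big_split sumrB /= -!mulr_sumr -/S sumr_const -mulr_natr -/N. ring.
have [A0|A0] := posnP #|A|.
  by move=> _; rewrite /N A0 mul0r /S (cards0_eq A0) big_set0 expr0n lexx.
by rewrite pmulr_rge0 ?subr_ge0// ltr0n.
Qed.

Lemma norm1_restr n (x : 'cV[R]_n) (A : {set 'I_n}) :
  norm1 (restr x A) = \sum_(i in A) `|x i 0|.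
Proof.
rewrite [RHS]big_mkcond; apply: eq_bigr => i _.
by rewrite mxE; case: ifP => _; rewrite ?normr0.
Qed.

Lemma norm1_restrD n (x : 'cV[R]_n) (A : {set 'I_n}) :
  norm1 x = norm1 (restr x A) + norm1 (restr x (~: A)).
Proof.
rewrite !norm1_restr /norm1 (bigID (mem A)) /=; congr (_ + _).
by apply: eq_bigl => i; rewrite inE.
Qed.

Lemma norm1_gt0 n (x : 'cV[R]_n) : (0 < norm1 x) = (x != 0).
Proof.
have n0 : 0 <= norm1 x by apply: sumr_ge0.
rewrite lt0r n0 andbT; congr (~~ _); apply/idP/eqP => [|->]; last first.
  by apply/eqP; apply: big1 => i _; rewrite mxE normr0.
rewrite psumr_eq0// => /allP x0; apply/colP => i; rewrite mxE.
by apply/eqP; rewrite -normr_eq0 (implyP (x0 i (mem_index_enum i))).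
Qed.

Lemma norm2_gt0 n (x : 'cV[R]_n) : (0 < norm2 x) = (x != 0).
Proof. by rewrite sqrtr_gt0 -/(sqnorm x) sqnorm_gt0. Qed.

Lemma norm2Z n (c : R) (x : 'cV[R]_n) : norm2 (c *: x) = `|c| * norm2 x.
Proof.
by rewrite /norm2 -/(sqnorm _) sqnormZ sqrtrM ?sqr_ge0// sqrtr_sqr.
Qed.

Lemma norm1Z n (c : R) (x : 'cV[R]_n) : norm1 (c *: x) = `|c| * norm1 x.
Proof. by rewrite /norm1 mulr_sumr; apply: eq_bigr => i _; rewrite mxE normrM. Qed.

Lemma restrZ n (c : R) (x : 'cV[R]_n) (A : {set 'I_n}) :
  restr (c *: x) A = c *: restr x A.
Proof. by apply/colP => i; rewrite !mxE; case: ifP => // _; rewrite mulr0. Qed.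

(** As [gamma < 1], the normalised [x] lies in [S_gamma], so [eta * norm2 x <= norm2 (D *m x)]. Half
    of the l1-mass of [x] sits on [A], so Cauchy-Schwarz gives [norm1 x <= 2 * sqrt s * norm2 x];
    squaring produces the 4. *)
Lemma cone_lower_bound d n s (gamma eta : R) (D : 'M[R]_(d, n)) (x : 'cV[R]_n)
    (A : {set 'I_n}) :
  0 < gamma < 1 -> 0 < eta ->
  (forall y, S_gamma s gamma y -> eta <= norm2 (D *m y)) ->
  x != 0 -> (#|A| <= s)%N -> norm1 (restr x (~: A)) <= norm1 (restr x A) ->
  eta ^+ 2 * norm1 x ^+ 2 <= 4 * s%:R * sqnorm (D *m x).
Proof.
move=> /andP[g0 g1] eta0 Dlow x0 As xA.
have nx0 : 0 < norm2 x by rewrite norm2_gt0.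
have Dx : eta ^+ 2 * sqnorm x <= sqnorm (D *m x).
  have /Dlow : S_gamma s gamma ((norm2 x)^-1 *: x).
    split; first by rewrite norm2Z gtr0_norm ?invr_gt0// mulVf// gt_eqF.
    exists A; split => //; rewrite !restrZ !norm1Z mulrCA ler_wpM2l//.
    rewrite (le_trans _ xA)// ler_piMl ?(ltW g1)//.
    by apply: sumr_ge0.
  rewrite -scalemxAr norm2Z gtr0_norm ?invr_gt0// ler_pdivlMl// mulrC => h.
  by rewrite -!sqr_norm2 -exprMn ler_pXn2r// nnegrE ?sqrtr_ge0// ltW// mulr_gt0.
have x1 : norm1 x <= 2 * norm1 (restr x A).
  by rewrite (norm1_restrD x A) mulr_natl mulr2n lerD2l.
have xs : norm1 (restr x A) ^+ 2 <= s%:R * sqnorm x.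
  rewrite norm1_restr (le_trans (sqr_sum_le _ _))//.
  have a0 : 0 <= \sum_(i in A) `|x i 0| ^+ 2.
    by apply: sumr_ge0 => i _; exact: sqr_ge0.
  rewrite ler_pM ?ler_nat ?ler0n//.
  rewrite /sqnorm [leRHS](bigID (mem A)) /= -[leLHS]addr0 lerD//.
    by apply: ler_sum => i _; rewrite real_normK// num_real.
  by apply: sumr_ge0 => i _; exact: sqr_ge0.
have n1 : 0 <= norm1 x by rewrite ltW// norm1_gt0.
have {}x1 : norm1 x ^+ 2 <= 4 * norm1 (restr x A) ^+ 2.
  have -> : 4 * norm1 (restr x A) ^+ 2 = (2 * norm1 (restr x A)) ^+ 2 by ring.
  by rewrite ler_pXn2r// nnegrE// (le_trans n1).
have s0 : 0 <= s%:R :> R by [].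
have e2 : 0 <= eta ^+ 2 by exact: sqr_ge0.
rewrite (le_trans (ler_wpM2l e2 x1))//.
rewrite mulrCA -mulrA ler_pM2l// (le_trans (ler_wpM2l e2 xs))// mulrCA.
by rewrite ler_wpM2l.
Qed.

(** The vertices of the l1-ball, coded by an alphabet of [2n] letters. Words of length [k] then form
    a finite type with [(2n)^k] elements, ready for a union bound; their sums are left
    unnormalised. *)
Definition signed_unit n (a : 'I_n * bool) : 'cV[R]_n :=
  (-1) ^+ a.2 *: delta_mx a.1 0.

Definition net_point n k (t : k.-tuple ('I_n * bool)) : 'cV[R]_n :=
  \sum_(a <- t) signed_unit a.

Lemma signed_unit_sum n (x : 'cV[R]_n) :
  x = \sum_j `|x j 0| *: signed_unit (j, x j 0 < 0).
Proof.
apply/colP => i; rewrite summxE (bigD1 i)//= big1 ?addr0.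
  by rewrite !mxE !eqxx mulr1 mulrC -numEsign.
by move=> j ji; rewrite !mxE eq_sym (negbTE ji) /= !mulr0.
Qed.

Lemma sqnorm_signed_unit d n (D : 'M[R]_(d, n)) (a : 'I_n * bool) :
  sqnorm (D *m signed_unit a) = sqnorm (col a.1 D).
Proof. by rewrite -scalemxAr sqnormZ sqrr_sign mul1r colE. Qed.

(** The deterministic core: a counterexample [x] to the null space property yields a net point [y]
    that violates the lower bound with factor [b]. The last two hypotheses say that [k] is large
    enough for the sampling error to be harmless. *)
Lemma NSP_of_net m d n s k (gamma eta rho a b : R) (D : 'M[R]_(d, n))
    (Phi : 'M[R]_(m, d)) :
  0 < gamma < 1 -> 0 < eta -> 0 < rho -> 0 < a -> 0 <= b -> (0 < s)%N ->
  (forall y, S_gamma s gamma y -> eta <= norm2 (D *m y)) ->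
  (forall i, sqnorm (col i D) <= rho) ->
  (forall i, sqnorm (Phi *m col i D) <= a) ->
  (forall t : k.-tuple ('I_n * bool), D *m net_point t != 0 ->
    b * sqnorm (D *m net_point t) < sqnorm (Phi *m (D *m net_point t))) ->
  32 * s%:R * rho <= k%:R * eta ^+ 2 ->
  32 * s%:R * a <= b * k%:R * eta ^+ 2 ->
  NSP (Phi *m D) s.
Proof.
move=> g01 eta0 rho0 a0 b0 s0 Dlow Drho Pa Pb krho ka x Px x0 A As.
rewrite ltNge; apply/negP => xA.
have nx := norm1_gt0 x; rewrite x0 in nx.
have := cone_lower_bound g01 eta0 Dlow x0 As xA.
pose z := (norm1 x)^-1 *: x => xlow.
have zlow : eta ^+ 2 <= 4 * s%:R * sqnorm (D *m z).
  rewrite /z -scalemxAr sqnormZ mulrCA exprVn ler_pdivlMl ?exprn_gt0//.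
  by rewrite mulrC.
have Pz : Phi *m D *m z = 0 by rewrite /z -scalemxAr Px scaler0.
(* Stacking the two rescaled maps lets one application of [maurey] control both errors: each block
   contributes at most 1 on a vertex, whence the bound 2. *)
pose M := col_mx ((Num.sqrt rho)^-1 *: D) ((Num.sqrt a)^-1 *: (Phi *m D)).
have sM y : sqnorm (M *m y) = rho^-1 * sqnorm (D *m y)
    + a^-1 * sqnorm (Phi *m (D *m y)).
  rewrite mul_col_mx sqnorm_col_mx -!scalemxAl !sqnormZ !exprVn.
  by rewrite !sqr_sqrtr ?ltW// mulmxA.
(* The signs are dictated by [x], so only indices are drawn, with weights [|z j|] summing to 1;
   [map_tuple sgn] puts the signs back. *)
pose sgn j := (j, x j 0 < 0).
have := @maurey R _ _ (fun j : 'I_n => `|z j 0|) (fun j => M *m signed_unit (sgn j))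
  2 k.
case.
- by [].
- have -> : \sum_j `|z j 0| = norm1 z by [].
  by rewrite norm1Z gtr0_norm ?invr_gt0// mulVf// gt_eqF.
- move=> j; rewrite sM mulmxA !sqnorm_signed_unit /=.
  have -> : col j (Phi *m D) = Phi *m col j D by rewrite !colE mulmxA.
  have : rho^-1 * sqnorm (col j D) <= 1 by rewrite ler_pdivrMl// mulr1.
  have : a^-1 * sqnorm (Phi *m col j D) <= 1 by rewrite ler_pdivrMl// mulr1.
  lra.
move=> t; set y := net_point (map_tuple sgn t).
have -> : \sum_(j <- t) M *m signed_unit (sgn j) = M *m y.
  by rewrite /y /net_point big_map mulmx_sumr.
have -> : \sum_j `|z j 0| *: (M *m signed_unit (sgn j)) = M *m z.
  under eq_bigr do rewrite scalemxAr.
  rewrite -mulmx_sumr [in RHS](signed_unit_sum z); congr (_ *m _).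
  apply: eq_bigr => j _; congr (_ *: signed_unit (_, _)).
  by rewrite mxE pmulr_rlt0// invr_gt0.
rewrite scalemxAr -mulmxBr sM !mulmxBr -[D *m (_ *: z)]scalemxAr.
rewrite -[Phi *m (_ *: _)]scalemxAr (mulmxA Phi D z) Pz scaler0 subr0.
set u := D *m y - k%:R *: (D *m z) => small.
have y0 : 0 <= sqnorm u by exact: sqnorm_ge0.
have py0 : 0 <= sqnorm (Phi *m (D *m y)) by exact: sqnorm_ge0.
have U0 : 0 <= rho^-1 * sqnorm u by rewrite mulr_ge0// invr_ge0 ltW.
have V0 : 0 <= a^-1 * sqnorm (Phi *m (D *m y)) by rewrite mulr_ge0// invr_ge0 ltW.
have usmall : sqnorm u <= rho * (k%:R * 2) by rewrite -ler_pdivrMl//; lra.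
have pysmall : sqnorm (Phi *m (D *m y)) <= a * (k%:R * 2).
  by rewrite -ler_pdivrMl//; lra.
have kz : k%:R ^+ 2 * sqnorm (D *m z) <= 2 * sqnorm (D *m y) + 2 * sqnorm u.
  by rewrite -sqnormZ (le_trans _ (sqnormB_le _ _))// /u opprB addrC subrK.
have sp : 0 < s%:R :> R by rewrite ltr0n.
have kp : 0 < k%:R :> R.
  rewrite ltr0n lt0n; apply: contraTneq krho => ->.
  by rewrite mul0r -ltNge !mulr_gt0.
(* From [zlow], [kz] and [usmall], [k^2 eta^2 <= 8 s |Dy|^2 + 16 s k rho]. By [krho] the last term
   is at most half of the left side and is absorbed. *)
have ylow : k%:R ^+ 2 * eta ^+ 2 <= 16 * s%:R * sqnorm (D *m y).
  have h1 := ler_wpM2l (sqr_ge0 k%:R) zlow.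
  have h2 := ler_wpM2l (ltW sp) kz.
  have h3 := ler_wpM2l (ltW sp) usmall.
  have h4 := ler_wpM2l (ltW kp) krho.
  by nra.
have Dy0 : D *m y != 0.
  apply: contraTneq ylow => ->.
  by rewrite sqnorm0 mulr0 -ltNge mulr_gt0// exprn_gt0.
have := Pb _ Dy0; rewrite ltNge => /negP; apply.
(* After scaling by [16 s] the chain is [32 s k a <= b k^2 eta^2 <= 16 s b |Dy|^2], by [ka] and
   [ylow]. *)
rewrite (le_trans pysmall)// -(@ler_pM2l _ (16 * s%:R)) ?mulr_gt0//.
have h1 := ler_wpM2l b0 ylow.
have h2 := ler_wpM2l (ltW kp) ka.
by nra.
Qed.

End SparseApproximation.

(** * Extreme eigenvalues as Rayleigh quotients *)

Section Rayleigh.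
Set Implicit Arguments.
Unset Strict Implicit.
Context {R : realType}.

Lemma sum_coord_continuous d (f : 'I_d -> 'rV[R]_d -> R) :
  (forall i, continuous (f i)) -> continuous (fun x => \sum_i f i x).
Proof.
move=> fc; elim: (index_enum _) => [|i r IH].
  by under eq_fun do rewrite big_nil; exact: cst_continuous.
under eq_fun do rewrite big_cons.
by move=> x; exact: (cvgD (fc i x) (IH x)).
Qed.

Lemma form_continuous d (A : 'M[R]_d) :
  continuous (fun x : 'rV[R]_d => (x *m A *m x^T) 0 0).
Proof.
have cc i : continuous (fun x : 'rV[R]_d => x 0 i) by exact: coord_continuous.
have -> : (fun x : 'rV[R]_d => (x *m A *m x^T) 0 0) =
    (fun x => \sum_i (\sum_j x 0 j * A j i) * x 0 i).
  by apply/funext => x; rewrite mxE; apply: eq_bigr => i _; rewrite !mxE.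
apply: sum_coord_continuous => i x.
apply: (fun h => cvgM h (cc i x)).
apply: (@sum_coord_continuous d (fun j x => x 0 j * A j i)) => j y.
by apply: (cvgM (cc j y)); exact: cst_continuous.
Qed.

Lemma sphere_compact d : compact [set x : 'rV[R]_d | (x *m x^T) 0 0 = 1].
Proof.
apply: bounded_closed_compact.
  exists 1; split => // M M1 x /= x1.
  rewrite (le_trans _ (ltW M1))//.
  rewrite /Num.norm /= mx_normrE; apply/bigmax_leP; split => // -[i j] _ /=.
  rewrite -(expr_le1 (n := 2))// real_normK ?num_real// -x1 mxE (bigD1 j)//=.
  rewrite mxE ord1 -expr2 lerDl; apply: sumr_ge0 => l _.
  by rewrite mxE -expr2 sqr_ge0.
have -> : [set x : 'rV[R]_d | (x *m x^T) 0 0 = 1] =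
    (fun x : 'rV[R]_d => (x *m 1%:M *m x^T) 0 0) @^-1` [set 1].
  by apply/seteqP; split => x /=; rewrite mulmx1.
by apply: preimage_closed; [move=> x _; exact: form_continuous|exact: closed_eq].
Qed.

Lemma mulmx_tr_sqnorm d (x : 'rV[R]_d) : (x *m x^T) 0 0 = sqnorm x^T.
Proof. by rewrite mxE; apply: eq_bigr => i _; rewrite !mxE expr2. Qed.

Lemma form_line d (B : 'M[R]_d) (v y : 'rV[R]_d) (t : R) : B^T = B ->
  ((v + t *: y) *m B *m (v + t *: y)^T) 0 0 =
  (v *m B *m v^T) 0 0 + 2 * t * (v *m B *m y^T) 0 0
    + t ^+ 2 * (y *m B *m y^T) 0 0.
Proof.
move=> symB.
have D00 (M N : 'M[R]_1) : (M + N) 0 0 = M 0 0 + N 0 0 by rewrite mxE.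
have Z00 e (M : 'M[R]_1) : (e *: M) 0 0 = e * M 0 0 by rewrite mxE.
have yv : (y *m B *m v^T) 0 0 = (v *m B *m y^T) 0 0.
  rewrite -[in LHS](trmxK (y *m B *m v^T)) [LHS]mxE !trmx_mul symB trmxK.
  by rewrite mulmxA.
have -> : (v + t *: y)^T = v^T + t *: y^T by apply/matrixP => i j; rewrite !mxE.
by rewrite !mulmxDl !mulmxDr -!scalemxAl -!scalemxAr !(D00, Z00) yv; ring.
Qed.

(** The form attains a maximum [mu] on the compact unit sphere, nonempty in dimension [d.+1];
    homogeneity extends the bound to all [x], and the first-order condition makes the maximiser an
    eigenvector. *)
Lemma Rayleigh_max d (A : 'M[R]_d.+1) : A^T = A ->
  exists2 mu, (exists2 v : 'rV[R]_d.+1, v != 0 & v *m A = mu *: v) &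
    forall x : 'rV[R]_d.+1, (x *m A *m x^T) 0 0 <= mu * (x *m x^T) 0 0.
Proof.
move=> symA; set S := [set x : 'rV[R]_d.+1 | (x *m x^T) 0 0 = 1].
have S0 : S !=set0.
  by exists (delta_mx 0 0); rewrite /S /= trmx_delta mul_delta_mx mxE eqxx.
have [v vS vmax] := compact_EVT_max S0 (@sphere_compact d.+1)
  (continuous_subspaceT (@form_continuous _ A)).
set mu := (v *m A *m v^T) 0 0 in vmax.
have {vS}v1 : (v *m v^T) 0 0 = 1 by rewrite inE in vS.
have quad (x : 'rV_d.+1) : (x *m A *m x^T) 0 0 <= mu * (x *m x^T) 0 0.
  have [->|x0] := eqVneq x 0; first by rewrite !mul0mx mxE mulr0.
  have px : 0 < (x *m x^T) 0 0.
    by rewrite mulmx_tr_sqnorm sqnorm_gt0 trmx_eq0.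
  pose c := (Num.sqrt ((x *m x^T) 0 0))^-1.
  have c2 : c * c = ((x *m x^T) 0 0)^-1.
    by rewrite -expr2 exprVn sqr_sqrtr// ltW.
  have scale (C : 'M[R]_1) : (c *: (c *: C)) 0 0 = ((x *m x^T) 0 0)^-1 * C 0 0.
    by rewrite scalerA mxE c2.
  have /vmax : (c *: x \in S).
    rewrite inE /S /= linearZ /= -scalemxAl -scalemxAr scale mulVf//.
    by rewrite gt_eqF.
  rewrite linearZ /= -!scalemxAl -scalemxAr scale -/mu.
  by rewrite ler_pdivrMl// mulrC.
exists mu => //; exists v.
  by apply: contra_eq_neq v1 => ->; rewrite mul0mx mxE eq_sym oner_eq0.
(* [q x = mu |x|^2 - x A x^T] is nonnegative and vanishes at [v], so its
   polar form vanishes at [v]: perturb [v] in the direction of [v *m B]. *)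
pose B := mu%:M - A; pose y := v *m B.
have symB : B^T = B by rewrite linearB /= tr_scalar_mx symA.
have qE (x : 'rV_d.+1) :
    (x *m B *m x^T) 0 0 = mu * (x *m x^T) 0 0 - (x *m A *m x^T) 0 0.
  by rewrite mulmxBr mulmxBl mul_mx_scalar -scalemxAl !mxE.
have q0 (x : 'rV_d.+1) : 0 <= (x *m B *m x^T) 0 0 by rewrite qE subr_ge0.
pose b := (y *m y^T) 0 0; pose c := (y *m B *m y^T) 0 0.
have expand t : ((v + t *: y) *m B *m (v + t *: y)^T) 0 0 = 2 * t * b + t ^+ 2 * c.
  by rewrite form_line// qE v1 -/mu mulr1 subrr add0r.
have b0 : 0 <= b by rewrite /b mulmx_tr_sqnorm sqnorm_ge0.
have c0 : 0 <= c by exact: q0.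
have : y = 0.
  apply: contraTeq isT => y0; apply/negP => _.
  have bp : 0 < b by rewrite /b mulmx_tr_sqnorm sqnorm_gt0 trmx_eq0.
  (* With [t (c + 1) = b] the value [-2 t b + t^2 c] equals [- t b - t^2 < 0]; the 1 keeps the
     denominator positive when [c = 0]. *)
  have := q0 (v + (- (b / (c + 1))) *: y); rewrite expand.
  set t := b / (c + 1).
  have tE : t * (c + 1) = b by rewrite divfK// gt_eqF// ltr_wpDl.
  have tp : 0 < t by rewrite divr_gt0// ltr_wpDl.
  by rewrite sqrrN; nra.
rewrite /y mulmxBr mul_mx_scalar => /eqP; rewrite subr_eq0 => /eqP <-.
by [].
Qed.

Lemma singular_value_eigen d (A : 'M[R]_d) (mu : R) (v : 'rV[R]_d) :
  A^T = A -> 0 <= mu -> v != 0 -> v *m A = mu *: v -> singular_value A mu.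
Proof.
move=> symA mu0 v0 vA; split => //; apply/eigenvalueP; exists v => //.
by rewrite symA mulmxA vA -scalemxAl vA scalerA expr2.
Qed.

(** Eigenvalues of a positive definite matrix are positive, hence singular values, hence in
    [[smin, smax]]. The extreme values of the Rayleigh quotient are eigenvalues, by [Rayleigh_max]
    for [A] and for [- A]. *)
Lemma pos_def_singular_bounds d (A : 'M[R]_d) (smin smax : R) :
  pos_def A -> singular_value A smin -> singular_value A smax ->
  (forall sv, singular_value A sv -> smin <= sv <= smax) ->
  0 < smin /\ forall x : 'rV[R]_d,
    smin * (x *m x^T) 0 0 <= (x *m A *m x^T) 0 0 <= smax * (x *m x^T) 0 0.
Proof.
move=> [symA posA] [smin0 /eigenvalueP[w wA w0]] _ bounds.
case: d A symA posA smin0 w wA w0 bounds => [|d] A symA posA smin0 w wA w0 bounds.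
  by move: w0; rewrite thinmx0 eqxx.
have eigen_pos mu (v : 'rV[R]_d.+1) : v != 0 -> v *m A = mu *: v -> 0 < mu.
  move=> v0 vA; have := posA v v0.
  rewrite vA -scalemxAl mxE mulmx_tr_sqnorm pmulr_lgt0//.
  by rewrite sqnorm_gt0 trmx_eq0.
have bound mu (v : 'rV[R]_d.+1) : v != 0 -> v *m A = mu *: v -> smin <= mu <= smax.
  move=> v0 vA; apply: bounds.
  by apply: (singular_value_eigen symA _ v0 vA); rewrite ltW// (eigen_pos _ v).
split.
  (* If [smin = 0] then [w A A = 0], so [|w A|^2 = w A A w^T = 0] and [w A = 0], against positive
     definiteness. *)
  rewrite lt0r smin0 andbT; apply: contraNneq w0 => smin_eq0.
  rewrite smin_eq0 expr0n scale0r symA mulmxA in wA.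
  have wA0 : w *m A = 0.
    apply/trmx_inj/eqP; rewrite trmx0 -sqnorm_eq0 -mulmx_tr_sqnorm.
    by rewrite trmx_mul symA mulmxA wA mul0mx mxE.
  apply/contraT => /posA; rewrite wA0 mul0mx mxE ltxx.
  by [].
move=> x; apply/andP; split; last first.
  have [mu [v v0 vA] quad] := Rayleigh_max symA.
  rewrite (le_trans (quad x))// ler_wpM2r//.
    by rewrite mulmx_tr_sqnorm sqnorm_ge0.
  by have /andP[] := bound mu v v0 vA.
have symNA : (- A)^T = - A by rewrite linearN /= symA.
have [mu [v v0 vA] quad] := Rayleigh_max symNA.
have := quad x; rewrite mulmxN mulNmx mxE lerNl; apply: le_trans.
rewrite -mulNr ler_wpM2r//; first by rewrite mulmx_tr_sqnorm sqnorm_ge0.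
have /(bound (- mu) v v0)/andP[//] : v *m A = - mu *: v.
by rewrite scaleNr -vA mulmxN opprK.
Qed.

End Rayleigh.

(** * Expectation of a product over independent rows *)

Section Density.
Set Implicit Arguments.
Unset Strict Implicit.
Local Open Scope ereal_scope.
Context d (T : measurableType d) (R : realType).
Variables (mu nu : {measure set T -> \bar R}) (c : T -> R).
Hypotheses (mc : measurable_fun setT c) (c0 : forall x, (0 <= c x)%R).
Hypothesis nuE : forall A, measurable A -> nu A = \int[mu]_(x in A) (c x)%:E.

Import HBNNSimple.

(** The hypothesis [nuE] is the case of indicators; linearity gives nonnegative simple functions,
    and monotone convergence along [nnsfun_approx] gives the rest. *)
Lemma ge0_integral_density (f : T -> \bar R) :
  measurable_fun setT f -> (forall x, 0 <= f x) ->
  \int[nu]_x f x = \int[mu]_x (f x * (c x)%:E).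
Proof.
move=> mf f0.
have mcE : measurable_fun setT (fun x => (c x)%:E) by exact/measurable_EFinP.
pose h := nnsfun_approx measurableT mf.
have hf x : (h n x)%:E @[n --> \oo] --> f x by apply: cvg_nnsfun_approx.
have ndh x : {homo (fun n => (h n x)%:E) : a b / (a <= b)%N >-> a <= b}.
  by move=> a b ab; rewrite lee_fin; exact/lefP/nd_nnsfun_approx.
have mh n : measurable_fun setT (fun x => (h n x)%:E) by exact/measurable_EFinP.
transitivity (limn (fun n => \int[nu]_x (h n x)%:E)).
  rewrite -monotone_convergence//.
    by apply: eq_integral => x _; apply/esym/cvg_lim => //; exact: hf.
  by move=> n x _; rewrite lee_fin.
transitivity (limn (fun n => \int[mu]_x ((h n x)%:E * (c x)%:E))); last first.
  rewrite -monotone_convergence//.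
  - apply: eq_integral => x _; apply/cvg_lim => //.
    by apply: cvgeZr => //; exact: hf.
  - by move=> n; exact: emeasurable_funM.
  - by move=> n x _; rewrite mule_ge0// lee_fin.
  - move=> x _ a b ab /=; rewrite lee_wpmul2r ?lee_fin//.
    exact/lefP/nd_nnsfun_approx.
congr (limn _); apply/funext => n.
transitivity (\int[nu]_x \sum_(y \in range (h n))
    (y * \1_(h n @^-1` [set y]) x)%:E).
  by apply: eq_integral => x _; rewrite fsumEFin// -fimfunE.
rewrite ge0_integral_fsum//; last 2 first.
- by move=> y; exact/measurable_EFinP/measurable_funM.
- by move=> y x _; exact: nnfun_muleindic_ge0.
transitivity (\int[mu]_x \sum_(y \in range (h n))
    ((y * \1_(h n @^-1` [set y]) x)%:E * (c x)%:E)); last first.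
  apply: eq_integral => x _; rewrite -ge0_mule_fsuml; last first.
    by move=> y; exact: nnfun_muleindic_ge0.
  by rewrite fsumEFin// -fimfunE.
rewrite ge0_integral_fsum//; last 2 first.
- by move=> y; apply: emeasurable_funM => //; exact/measurable_EFinP/measurable_funM.
- by move=> y x _; apply: mule_ge0; [exact: nnfun_muleindic_ge0|rewrite lee_fin].
apply: eq_fsbigr => r rh.
under eq_integral do rewrite EFinM.
rewrite integralZl_indic_nnsfun// integral_indic// setIT nuE//.
under [RHS]eq_integral do rewrite EFinM -muleA.
rewrite ge0_integralZl//.
- by rewrite integral_mkcond; congr (_ * _); apply: eq_integral => x _;
    rewrite patchE indicE; case: ifP => _; rewrite ?mul1e ?mul0e.
- by apply: emeasurable_funM => //; exact/measurable_EFinP/measurable_indic.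
- by move=> x _; rewrite mule_ge0// lee_fin.
- by move: rh; rewrite inE => -[x _ <-]; rewrite lee_fin.
Qed.

End Density.

Section IndependentRows.
Set Implicit Arguments.
Unset Strict Implicit.
Context {R : realType}.

(** Turns a weighted integral into a genuine measure, so that uniqueness of measures on a pi-system
    applies to it. *)
Lemma exists_density_measure dT (T : measurableType dT)
    (mu : {measure set T -> \bar R}) (c : T -> R) :
  measurable_fun setT c -> (forall x, 0 <= c x) ->
  exists nu : {measure set T -> \bar R},
    forall A, nu A = (\int[mu]_(x in A) (c x)%:E)%E.
Proof.
move=> mc c0; pose f A := (\int[mu]_(x in A) (c x)%:E)%E.
have f0 : f set0 = 0%E by rewrite /f integral_set0.
have fge0 A : (0 <= f A)%E by apply: integral_ge0 => x _; rewrite lee_fin.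
have fadd : semi_sigma_additive f.
  apply: semi_sigma_additive_nng_induced; first exact/measurable_EFinP.
  by move=> x; rewrite lee_fin.
pose mix := isMeasure.Build _ _ _ f f0 fge0 fadd.
pose nu : {measure set T -> \bar R} := HB.pack f mix.
by exists nu.
Qed.

Definition row_rect d T (X : 'I_d -> T -> R) (B : 'I_d -> set R) : set T :=
  \bigcap_(j in [set: 'I_d]) (X j @^-1` B j).

(** The pi-system on which [indep_rows] states its product rule; the rule has to be carried over to
    the sigma-algebra generated by it, where linear functionals of the row are measurable. *)
Definition row_rects d T (X : 'I_d -> T -> R) : set (set T) :=
  [set row_rect X B | B in [set B | forall j, measurable (B j)]].

Lemma row_rects_setI d T (X : 'I_d -> T -> R) : setI_closed (row_rects X).
Proof.
move=> _ _ [B mB <-] [C mC <-]; exists (fun j => B j `&` C j).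
  by move=> j; exact: measurableI.
by rewrite /row_rect -bigcapI.
Qed.

Lemma row_rect_setT d T (X : 'I_d -> T -> R) : row_rect X (fun=> setT) = setT.
Proof. by apply/seteqP; split => // x _ j _. Qed.

Lemma measurable_row_rect d dT (T : measurableType dT) (X : 'I_d -> T -> R) B :
  (forall j, measurable_fun setT (X j)) -> (forall j, measurable (B j)) ->
  measurable (row_rect X B).
Proof.
move=> mX mB; apply: fin_bigcap_measurable => // j _.
by rewrite -[X in measurable X]setTI; exact: mX.
Qed.

Lemma row_linear_measurable d (T : pointedType) (X : 'I_d -> T -> R)
    (a : 'I_d -> R) (B : set R) :
  measurable B -> <<s row_rects X >> ((fun w => \sum_j a j * X j w) @^-1` B).
Proof.
move=> mB.
pose Ts : measurableType _ := g_sigma_algebraType (row_rects X).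
have mX j : measurable_fun (T := Ts) setT (X j).
  move=> _ C mC; rewrite setTI; apply: sub_sigma_algebra.
  exists (fun l => if l == j then C else setT).
    by move=> l; case: ifP.
  apply/seteqP; split => [w /(_ j I)|w Cw l _] /=; first by rewrite eqxx.
  by case: eqP => // ->.
rewrite -[X in <<s _ >> X]setTI.
suff : measurable_fun (T := Ts) setT (fun w => \sum_j a j * X j w).
  by move=> mS; exact: (mS measurableT B mB).
apply: measurable_sum => j; apply: measurable_funM => //; exact: mX.
Qed.

Variables (m d : nat) (dT : measure_display) (T : measurableType dT).
Variables (P : probability T R) (X : 'I_m -> 'I_d -> T -> R).
Hypothesis mX : forall i j, measurable_fun setT (X i j).
Hypothesis indX : indep_rows P X.
Variables (Z : 'I_m -> T -> R) (f : R -> R) (L : 'I_m -> R).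
Hypothesis ZE : forall i B, measurable B -> <<s row_rects (X i) >> (Z i @^-1` B).
Hypotheses (mf : measurable_fun setT f) (f0 : forall x, 0 <= f x).
Hypothesis intf : forall i, (\int[P]_w (f (Z i w))%:E = (L i)%:E)%E.

Let mZ i : measurable_fun setT (Z i).
Proof.
move=> _ B mB; rewrite setTI.
have Gm : row_rects (X i) `<=` measurable.
  by move=> _ [C mC <-]; apply: measurable_row_rect => // j; exact: mX.
exact: (smallest_sub (@sigma_algebra_measurable _ T) Gm (@ZE i B mB)).
Qed.

Let L0 i : 0 <= L i.
Proof. by rewrite -lee_fin -intf integral_ge0// => w _; rewrite lee_fin. Qed.

(* Hybrid of the two products: the first [k] factors are already [f (Z i)],
   the other ones are still indicators of rectangles. *)
Let hyb (k : nat) (A : 'I_m -> 'I_d -> set R) (i : 'I_m) (w : T) : R :=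
  if (i < k)%N then f (Z i w) else \1_(row_rect (X i) (A i)) w.

Let hybL (k : nat) (A : 'I_m -> 'I_d -> set R) (i : 'I_m) : R :=
  if (i < k)%N then L i else fine (P (row_rect (X i) (A i))).

Let hyb0 k A i w : 0 <= hyb k A i w.
Proof. by rewrite /hyb; case: ifP. Qed.

Let hybL0 k A i : 0 <= hybL k A i.
Proof. by rewrite /hybL; case: ifP => // _; exact: fine_ge0. Qed.

Let mhyb k A i : (forall i j, measurable (A i j)) ->
  measurable_fun setT (hyb k A i).
Proof.
move=> mA; rewrite /hyb; case: (i < k)%N; first exact: measurableT_comp.
by apply: measurable_indic; exact: measurable_row_rect.
Qed.

(** Induction on [k], turning the indicator of row [k] into [f (Z k)]. The product [c] of the other
    factors is the density of a measure [nu]; the induction hypothesis says that [nu] and [K * P]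
    agree on rectangles of row [k], hence on the sigma-algebra they generate, hence [Z k] has the
    same law under both. *)
Let hybrid_expectation k A : (k <= m)%N -> (forall i j, measurable (A i j)) ->
  (\int[P]_w (\prod_i hyb k A i w)%:E = (\prod_i hybL k A i)%:E)%E.
Proof.
elim: k A => [|k IH] A.
  move=> _ mA; rewrite /hyb /hybL /=.
  transitivity (P (\bigcap_(i in [set: 'I_m]) row_rect (X i) (A i))).
    rewrite -[X in P X]setIT -integral_indic//; last first.
      by apply: fin_bigcap_measurable => // i _; apply: measurable_row_rect => // j.
    apply: eq_integral => w _; congr (_%:E); rewrite indicE.
    have [wA|] := boolP (w \in _); rewrite ?inE.
      apply: big1 => i _; rewrite indicE mem_set//.
      by move: wA; rewrite inE => /(_ i I).
    rewrite notin_setE => wA; apply/eqP; rewrite prodf_seq_eq0 /=.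
    apply/hasP; apply: contrapT => no; apply: wA => i _.
    apply: contrapT => wi; apply: no; exists i; rewrite ?mem_index_enum//.
    by rewrite indicE memNset.
  rewrite -prodEFin; transitivity (\prod_(i < m) P (row_rect (X i) (A i)))%E.
    exact: indX.
  by apply: eq_bigr => i _; rewrite fineK// fin_num_measure//;
    apply: measurable_row_rect => // j.
move=> km mA; pose i0 := Ordinal km.
pose c w := \prod_(i | i != i0) hyb k.+1 A i w.
pose K := \prod_(i | i != i0) hybL k.+1 A i.
have mc : measurable_fun setT c.
  have -> : c = fun w =>
      \prod_(i <- [seq i <- index_enum _ | i != i0]) hyb k.+1 A i w.
    by apply/funext => w; rewrite big_filter.
  by apply: measurable_prod => i _; exact: mhyb.
have c0 w : 0 <= c w by apply: prodr_ge0.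
have K0 : 0 <= K by apply: prodr_ge0.
have [nu nuE] := exists_density_measure P mc c0.
pose kP := mscale (NngNum K0) P.
have nu_rect B : (forall j, measurable (B j)) ->
    nu (row_rect (X i0) B) = kP (row_rect (X i0) B).
  (* The induction hypothesis holds for all rectangles, so that of row [i0] may be replaced by an
     arbitrary [B] while the other factors stay fixed. *)
  move=> mB; pose A' i := if i == i0 then B else A i.
  have mA' i j : measurable (A' i j) by rewrite /A'; case: ifP.
  have same i : i != i0 ->
      (hyb k A' i = hyb k.+1 A i) * (hybL k A' i = hybL k.+1 A i).
    move=> ii0; rewrite /hyb /hybL /A' (negbTE ii0).
    by rewrite [(i < k.+1)%N]ltnS [(i <= k)%N]leq_eqVlt
      (negbTE (ii0 : i != k :> nat)).
  have := IH A' (ltnW km) mA'.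
  rewrite (bigD1 i0)//= /hybL ltnn -/(hybL k A') /A' eqxx.
  rewrite (eq_bigr (hybL k.+1 A)) => [|i /same[_ <-]//]; rewrite -/K.
  rewrite EFinM fineK ?fin_num_measure//; last exact: measurable_row_rect.
  rewrite muleC => KP; transitivity (K%:E * P (row_rect (X i0) B))%E; last by [].
  rewrite -KP nuE [LHS]integral_mkcond.
  apply: eq_integral => w _; rewrite (bigD1 i0)//= patchE {1}/hyb ltnn eqxx indicE.
  rewrite (eq_bigr (fun i => hyb k.+1 A i w)) => [|i /same[-> _]//].
  by rewrite -/(c w); case: ifP; rewrite ?mul1r ?mul0r.
have G_setT : row_rects (X i0) setT.
  by exists (fun=> setT) => //; exact: row_rect_setT.
have nuZ B : measurable B -> nu (Z i0 @^-1` B) = kP (Z i0 @^-1` B).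
  move=> mB.
  apply: (g_sigma_algebra_measure_unique (row_rects (X i0)) _ (fun=> setT)).
  - by move=> _ [C mC <-]; apply: measurable_row_rect => // j; exact: mX.
  - by [].
  - by rewrite bigcup_const.
  - exact: row_rects_setI.
  - by move=> _ [C mC <-]; exact: nu_rect.
  - move=> _; rewrite -(row_rect_setT (X i0)) nu_rect// row_rect_setT.
    by rewrite /kP /mscale /= probability_setT mule1 ltry.
  - exact: ZE.
have mfZ : measurable_fun setT (EFin \o f) by exact/measurable_EFinP.
transitivity (\int[nu]_w (f (Z i0 w))%:E)%E.
  rewrite (@ge0_integral_density _ _ _ P nu c)//.
  - apply: eq_integral => w _; rewrite (bigD1 i0)//= {1}/hyb ltnSn EFinM.
    by [].
  - by apply/measurable_EFinP; exact: measurableT_comp.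
  - by move=> w; rewrite lee_fin.
transitivity (\int[kP]_w (f (Z i0 w))%:E)%E.
  have /= <- := ge0_integral_pushforward (mZ i0) nu measurableT mfZ
    (fun y _ => f0 y : (0 <= (f y)%:E)%E).
  have /= <- := ge0_integral_pushforward (mZ i0) kP measurableT mfZ
    (fun y _ => f0 y : (0 <= (f y)%:E)%E).
  by apply: eq_measure_integral => B mB _; exact: nuZ.
rewrite ge0_integral_mscale//=.
- by rewrite intf (bigD1 i0)//= {1}/hybL ltnSn mulrC.
- by apply/measurable_EFinP; exact: measurableT_comp.
- by move=> w _; rewrite lee_fin.
Qed.

Lemma independent_rows_expectation :
  (\int[P]_w (\prod_i f (Z i w))%:E = (\prod_i L i)%:E)%E.
Proof.
have := @hybrid_expectation m (fun _ _ => setT) (leqnn m) (fun _ _ => measurableT).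
rewrite (eq_bigr L); last by move=> i _; rewrite /hybL ltn_ord.
move=> <-; apply: eq_integral => w _; congr (_%:E).
by apply: eq_bigr => i _; rewrite /hyb ltn_ord.
Qed.

End IndependentRows.

(** * Chernoff bounds for Gaussian squares *)

Section GaussianTails.
Set Implicit Arguments.
Unset Strict Implicit.
Context {R : realType}.

(* [exp (- (r^2 - 1) x^2 / (2 tau^2))] times the density of [N(0, tau^2)] is
   [1 / r] times the density of [N(0, (tau / r)^2)]. *)
Lemma normal_exp_square (tau r : R) : 0 < tau -> 0 < r ->
  (\int[normal_prob 0 tau]_x
     (expR (- ((r ^+ 2 - 1) / (2 * tau ^+ 2) * x ^+ 2)))%:E = (r^-1)%:E)%E.
Proof.
move=> tau0 r0.
have mexp : measurable_fun setT
    (fun x : R => expR (- ((r ^+ 2 - 1) / (2 * tau ^+ 2) * x ^+ 2))).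
  apply: measurableT_comp => //; apply: measurableT_comp => //.
  by apply: measurable_funM => //; exact: measurable_funX.
rewrite (@ge0_integral_density _ _ _ lebesgue_measure _ (normal_pdf 0 tau)).
- have mpdf : measurable_fun setT (fun x : R => (normal_pdf 0 (tau / r) x)%:E).
    by apply/measurable_EFinP; exact: measurable_normal_pdf.
  have pdf0 (x : R) : setT x -> (0 <= (normal_pdf 0 (tau / r) x)%:E)%E.
    by move=> _; rewrite lee_fin normal_pdf_ge0.
  have ri0 : (0 <= (r^-1)%:E :> \bar R)%E by rewrite lee_fin invr_ge0 ltW.
  rewrite -[RHS]mule1 -(integral_normal_pdf 0 (tau / r)).
  have <- := @ge0_integralZl _ _ _ lebesgue_measure _ measurableT _ mpdf _ pdf0 ri0.
  apply: eq_integral => x _; rewrite -!EFinM; congr (_%:E).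
  have tr0 : 0 < tau / r by rewrite divr_gt0.
  rewrite !normal_pdfE ?gt_eqF// /normal_peak /normal_fun !subr0.
  have -> : Num.sqrt ((tau / r) ^+ 2 * pi *+ 2) =
      r^-1 * Num.sqrt (tau ^+ 2 * pi *+ 2).
    rewrite -[r^-1 in RHS]gtr0_norm ?invr_gt0// -sqrtr_sqr -sqrtrM ?sqr_ge0//.
    by congr (Num.sqrt _); rewrite exprMn exprVn -mulrnAr; ring.
  set S := Num.sqrt _.
  rewrite [(r^-1 * S)^-1]invfM invrK !mulrA mulVf ?gt_eqF// mul1r [_ * S^-1]mulrC.
  rewrite -[LHS]mulrA -expRD; congr (_ * expR _); field.
  by rewrite !gt_eqF.
- exact: measurable_normal_pdf.
- by move=> x; exact: normal_pdf_ge0.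
- by [].
- exact/measurable_EFinP.
- by move=> x; rewrite lee_fin expR_ge0.
Qed.

Lemma markov_expR dT (T : measurableType dT) (P : probability T R)
    (g : T -> R) (A : set T) (t e : R) :
  measurable_fun setT g -> (forall w, 0 <= g w) -> measurable A ->
  (forall w, A w -> expR t <= g w) -> (\int[P]_w (g w)%:E = e%:E)%E ->
  (P A <= (expR (- t) * e)%:E)%E.
Proof.
move=> mg g0 mA Ag ge.
have mgE D : measurable_fun D (EFin \o g).
  by apply/measurable_funTS/measurable_EFinP.
rewrite expRN EFinM -ge lee_pdivlMl ?expR_gt0//.
rewrite -integral_cst//.
apply: (@le_trans _ _ (\int[P]_(w in A) (g w)%:E)%E).
  apply: ge0_le_integral => //.
  by move=> w _; rewrite lee_fin expR_ge0.
apply: ge0_subset_integral => //.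
by move=> w _; rewrite lee_fin.
Qed.

Variables (m d : nat) (dT : measure_display) (T : measurableType dT).
Variables (P : probability T R) (X : 'I_m -> 'I_d -> T -> R) (Sigma : 'M[R]_d).
Hypothesis mX : forall i j, measurable_fun setT (X i j).
Hypothesis indX : indep_rows P X.
Hypothesis gaussX : forall i, gaussian_row P X Sigma i.
Hypothesis posSigma : pos_def Sigma.

Lemma sqnorm_rand_mx (v : 'cV[R]_d) w :
  sqnorm (rand_mx X w *m v) = \sum_i (\sum_j v^T 0 j * X i j w) ^+ 2.
Proof.
apply: eq_bigr => i _; rewrite mxE; congr (_ ^+ 2).
by apply: eq_bigr => j _; rewrite !mxE mulrC.
Qed.

Lemma measurable_sqnorm_rand_mx (v : 'cV[R]_d) :
  measurable_fun setT (fun w => sqnorm (rand_mx X w *m v)).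
Proof.
under eq_fun do rewrite sqnorm_rand_mx.
apply: measurable_sum => i; apply: measurable_funX.
by apply: measurable_sum => j; apply: measurable_funM.
Qed.

(** Chernoff bound for a sum of [m] independent squares of variance [q]. Writing the exponential
    rate as [(r^2 - 1) / (2 q)] makes each factor have mean [r^-1]; [r > 1] serves lower tails and
    [r < 1] upper tails. *)
Lemma gaussian_tail (v : 'cV[R]_d) (A : set T) (r t : R) :
  let q := (v^T *m Sigma *m v) 0 0 in
  v != 0 -> 0 < r -> measurable A ->
  (forall w, A w ->
    t <= - ((r ^+ 2 - 1) / (2 * q) * sqnorm (rand_mx X w *m v))) ->
  (P A <= (expR (- t) * r ^- m)%:E)%E.
Proof.
move=> q v0 r0 mA At.
have vT0 : v^T != 0 by rewrite trmx_eq0.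
have q0 : 0 < q by have := posSigma.2 _ vT0; rewrite trmxK.
pose tau := Num.sqrt q.
have tau0 : 0 < tau by rewrite sqrtr_gt0.
have tauq : tau ^+ 2 = q by rewrite sqr_sqrtr// ltW.
pose f (x : R) := expR (- ((r ^+ 2 - 1) / (2 * tau ^+ 2) * x ^+ 2)).
pose Z i w := \sum_j v^T 0 j * X i j w.
have mf : measurable_fun setT f.
  apply: measurableT_comp => //; apply: measurableT_comp => //.
  by apply: measurable_funM => //; exact: measurable_funX.
have mZ i : measurable_fun setT (Z i).
  by apply: measurable_sum => j; apply: measurable_funM.
have intf i : (\int[P]_w (f (Z i w))%:E = (r^-1)%:E)%E.
  rewrite -(normal_exp_square tau0 r0).
  have mfE : measurable_fun (T := measurableTypeR R) setT (EFin \o f).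
    exact/measurable_EFinP.
  have mZR : measurable_fun (U := measurableTypeR R) setT (Z i) by exact: mZ.
  have /= <- := ge0_integral_pushforward mZR P measurableT mfE
    (fun y _ => expR_ge0 _ : (0 <= (f y)%:E)%E).
  apply: eq_measure_integral => B mB _; rewrite /pushforward.
  by have := gaussX i vT0 mB; rewrite trmxK.
have prodE w : \prod_i f (Z i w) =
    expR (- ((r ^+ 2 - 1) / (2 * q) * sqnorm (rand_mx X w *m v))).
  by rewrite -expR_sum sqnorm_rand_mx mulr_sumr -sumrN tauq.
apply: (markov_expR (g := fun w => \prod_i f (Z i w))) => //.
- apply: measurable_prod => i _; exact: measurableT_comp.
- by move=> w; apply: prodr_ge0 => i _; exact: expR_ge0.
- by move=> w /At; rewrite prodE ler_expR.
rewrite (independent_rows_expectation mX indX (L := fun=> r^-1))//.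
- by rewrite prodr_const card_ord exprVn.
- by move=> i B mB; exact: row_linear_measurable.
- by move=> x; exact: expR_ge0.
Qed.

Lemma gaussian_lower_tail (v : 'cV[R]_d) :
  let q := (v^T *m Sigma *m v) 0 0 in v != 0 ->
  (P [set w | (sqnorm (rand_mx X w *m v) <= m%:R / 6 * q)%R]
     <= (expR (- (m%:R / 4)))%:E)%E.
Proof.
move=> q v0.
have q0 : 0 < q by have := posSigma.2 v^T; rewrite trmxK trmx_eq0; exact.
have mA : measurable [set w | sqnorm (rand_mx X w *m v) <= m%:R / 6 * q].
  by rewrite -[X in measurable X]setTI; apply: measurable_fun_le => //;
    exact: measurable_sqnorm_rand_mx.
(* With [r = 2] the rate [3 / (2 q)] at level [m q / 6] gives [m / 4], and
   [exp (m/4) * 2^-m <= exp (m/4 - m/2)] since [1/2 <= exp (-1/2)]. *)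
have /(_ 2 (- (m%:R / 4))) := gaussian_tail v0 _ mA.
rewrite opprK => h; apply: (le_trans (h _ _)) => // [w /= Sq|].
  have -> : - (m%:R / 4) = - ((2 ^+ 2 - 1) / (2 * q) * (m%:R / 6 * q)) :> R.
    by field; rewrite gt_eqF.
  rewrite lerN2 ler_wpM2l// divr_ge0// ?mulr_ge0 ?(ltW q0)//; lra.
have half : 2^-1 <= expR (- 2^-1) :> R.
  by have := expR_ge1Dx (- 2^-1 : R); lra.
rewrite lee_fin -exprVn.
have : 2^-1 ^+ m <= expR (- 2^-1 * m%:R) :> R.
  by rewrite expRM_natr lerXn2r// nnegrE// expR_ge0.
move=> /(ler_wpM2l (expR_ge0 (m%:R / 4))) /le_trans; apply.
by rewrite -expRD ler_expR; lra.
Qed.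

Lemma gaussian_upper_tail (v : 'cV[R]_d) :
  let q := (v^T *m Sigma *m v) 0 0 in v != 0 ->
  (P [set w | (4 * m%:R * q <= sqnorm (rand_mx X w *m v))%R]
     <= (expR (- (m%:R / 2)))%:E)%E.
Proof.
move=> q v0.
have q0 : 0 < q by have := posSigma.2 v^T; rewrite trmxK trmx_eq0; exact.
have mA : measurable [set w | 4 * m%:R * q <= sqnorm (rand_mx X w *m v)].
  by rewrite -[X in measurable X]setTI; apply: measurable_fun_le => //;
    exact: measurable_sqnorm_rand_mx.
(* With [r = 1/2] the level [4 m q] gives [3 m / 2], and [exp (- 3m/2) * 2^m <= exp (- m/2)] since
   [2 <= e]. *)
have /(_ (2^-1) (3 / 2 * m%:R)) := gaussian_tail v0 _ mA.
move=> h; apply: (le_trans (h _ _)) => // [w /= Sq|].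
  have -> : 3 / 2 * m%:R = 3 / (8 * q) * (4 * m%:R * q) :> R.
    by field; rewrite gt_eqF.
  have -> : - ((2^-1 ^+ 2 - 1) / (2 * q) * sqnorm (rand_mx X w *m v)) =
      3 / (8 * q) * sqnorm (rand_mx X w *m v) by field; rewrite gt_eqF.
  by rewrite ler_wpM2l// divr_ge0// mulr_ge0// ltW.
have two : 2 <= expR 1 :> R by have := expR_ge1Dx (1 : R); lra.
rewrite lee_fin -exprVn invrK.
have : 2 ^+ m <= expR (1 * m%:R) :> R.
  by rewrite expRM_natr lerXn2r// nnegrE// expR_ge0.
move=> /(ler_wpM2l (expR_ge0 (- (3 / 2 * m%:R)))) /le_trans; apply.
by rewrite -expRD ler_expR; lra.
Qed.

End GaussianTails.

(** * Union bound and numerical estimate of the failure probability *)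

Section UnionBound.
Set Implicit Arguments.
Unset Strict Implicit.

Lemma union_bound (R : realType) dT (T : measurableType dT)
    (P : probability T R) (J : finType) (A : J -> set T) (c : R) :
  (forall j, measurable (A j)) -> (forall j, (P (A j) <= c%:E)%E) ->
  (P (\big[setU/set0]_j A j) <= (#|J|%:R * c)%:E)%E.
Proof.
move=> mA Ac.
have -> : #|J|%:R * c = \sum_(j : J) c.
  by rewrite big_const iter_addr addr0 mulr_natl.
elim: (index_enum J) => [|j r IH]; first by rewrite !big_nil measure0.
have mr : measurable (\big[setU/set0]_(i <- r) A i) by exact: bigsetU_measurable.
rewrite !big_cons EFinD; apply: (le_trans (measureU2 _ (mA j) mr)).
exact: (leeD (Ac j) IH).
Qed.

Lemma sub_bigsetU T (J : finType) (A : J -> set T) j :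
  A j `<=` \big[setU/set0]_j A j.
Proof. by move=> w Aw; rewrite (bigD1 j)//=; left. Qed.

(** Since [(2n)^k = exp (k l)] with [k l <= M / 47], each of the two terms is at most [exp (- M/8)].
    Their sum costs a factor [2 <= exp l] with [l <= M / 16], and [16 <= 128 e pi] leaves room. *)
Lemma failure_bound (R : realType) (m n k : nat) (c : R) :
  (0 < n)%N -> 1 <= c -> k%:R <= 769 * c ->
  47 * (769 * (c * ln (2 * n%:R))) <= m%:R ->
  n%:R * expR (- (m%:R / 2)) + (2 * n%:R) ^+ k * expR (- (m%:R / 4))
    <= expR (- (m%:R / (128 * expR 1 * pi))) :> R.
Proof.
move=> n0 c1 kc mc; set M := m%:R; set l := ln (2 * n%:R) in mc.
have nR : 1 <= n%:R :> R by rewrite ler1n.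
have N0 : 0 < 2 * n%:R :> R by lra.
have NE : 2 * n%:R = expR l :> R by rewrite lnK.
have l0 : 0 <= l by rewrite ln_ge0//; lra.
have M0 : 0 <= M by [].
have cl : l <= c * l by rewrite ler_peMl.
have kl : k%:R * l <= 769 * (c * l) by rewrite mulrA ler_wpM2r.
have lM : 16 * l <= M by lra.
have klM : 47 * (k%:R * l) <= M by lra.
have b1 : n%:R * expR (- (M / 2)) <= expR (- (M / 8)).
  have : n%:R * expR (- (M / 2)) <= expR l * expR (- (M / 2)).
    by rewrite ler_wpM2r ?expR_ge0// -NE; lra.
  by move=> /le_trans; apply; rewrite -expRD ler_expR; lra.
have b2 : (2 * n%:R) ^+ k * expR (- (M / 4)) <= expR (- (M / 8)).
  by rewrite NE -expRM_natl -expRD ler_expR; lra.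
have b3 : expR (- (M / 8)) + expR (- (M / 8)) <= expR (- (M / 16)).
  have : 2 * expR (- (M / 8)) <= expR l * expR (- (M / 8)).
    by rewrite ler_wpM2r ?expR_ge0// -NE; lra.
  rewrite mulr_natl mulr2n => /le_trans; apply.
  by rewrite -expRD ler_expR; lra.
have e2 : 2 <= expR 1 :> R by have := expR_ge1Dx (1 : R); lra.
have p2 := pi_ge2 R.
have epi : 16 <= 128 * expR 1 * pi :> R by nra.
rewrite (le_trans (lerD b1 b2))// (le_trans b3)// ler_expR lerN2 ler_wpM2l//.
by rewrite lef_pV2 ?posrE//; lra.
Qed.

Lemma exists_natr_between (R : realType) (a : R) : 0 <= a ->
  exists k : nat, a <= k%:R <= a + 1.
Proof.
move=> a0; exists (Num.truncn a).+1; rewrite ltW ?truncnS_gt//=.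
by rewrite -natr1 lerD2r truncn_le.
Qed.

End UnionBound.

(** * Choice of the parameters and of the good event *)

Theorem theorem5p1 (R : realType) (m d n s : nat) (gamma : R)
  (dT : measure_display) (T : measurableType dT) (P : probability T R)
  (X : 'I_m -> 'I_d -> T -> R) (Sigma : 'M[R]_d) (smin2 smax2 : R)
  (D : 'M[R]_(d, n)) (eta rho : R) :
  (1 <= s)%N -> (s <= n)%N -> 0 < gamma < 1 ->
  (forall i j, measurable_fun [set: T] (X i j)) ->
  pos_def Sigma ->
  (forall i, gaussian_row P X Sigma i) ->
  indep_rows P X ->
  singular_value Sigma smin2 -> singular_value Sigma smax2 ->
  (forall sv, singular_value Sigma sv -> smin2 <= sv <= smax2) ->
  0 < eta ->
  (forall x, S_gamma s gamma x -> eta <= norm2 (D *m x)) ->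
  (forall i : 'I_n, norm2 (col i D) ^+ 2 <= rho) ->
  (18 * 2 ^+ 9 * pi * expR 1) / eta ^+ 2 * (rho * (smax2 / smin2) / gamma ^+ 2)
    * s%:R * ln (2 * n%:R) <= m%:R ->
  exists E : set T, measurable E /\
    E `<=` [set w | NSP (rand_mx X w *m D) s] /\
    ((1 - expR (- (m%:R / (128 * expR 1 * pi))))%:E <= P E)%E.
Proof.
move=> s1 sn g01 mX posS gaussX indX svmin svmax svbounds eta0 Dlow Drho mlow.
have [smin0 form] := pos_def_singular_bounds posS svmin svmax svbounds.
have {}form (v : 'cV[R]_d) : smin2 * sqnorm v <= (v^T *m Sigma *m v) 0 0 <=
    smax2 * sqnorm v.
  by have := form v^T; rewrite mulmx_tr_sqnorm trmxK.
have minmax : smin2 <= smax2 by have /andP[] := svbounds _ svmin.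
have smax0 : 0 < smax2 by exact: lt_le_trans minmax.
have n0 : (0 < n)%N by exact: leq_trans sn.
have sR : 1 <= s%:R :> R by rewrite ler1n.
have eta2 : 0 < eta ^+ 2 by rewrite exprn_gt0.
have Drho' i : sqnorm (col i D) <= rho by rewrite -sqr_norm2.
(* A standard basis vector lies in [S_gamma] because [1 <= s], and [D] maps it to a column. This is
   what makes [c >= 1] below. *)
have eta_rho : eta ^+ 2 <= rho.
  pose i0 := Ordinal n0.
  have S0 : S_gamma s gamma (delta_mx i0 0 : 'cV[R]_n).
    split.
      rewrite /norm2 (bigD1 i0)//= big1 ?mxE ?eqxx ?expr1n ?addr0 ?sqrtr1//.
      by move=> i ii0; rewrite mxE (negbTE ii0) expr0n.
    exists [set i0]%SET; split; first by rewrite cards1.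
    rewrite !norm1_restr big1 ?mulr0 ?sumr_ge0// => i.
    by rewrite !inE => ii0; rewrite mxE (negbTE ii0) normr0.
  rewrite (le_trans _ (Drho i0))// ler_pXn2r ?nnegrE ?sqrtr_ge0 ?(ltW eta0)//.
  by rewrite colE; exact: Dlow.
have rho0 : 0 < rho by exact: lt_le_trans eta_rho.
(* This is [s rho kappa / eta^2], the scale of both [k] and [m]. *)
pose c := s%:R * rho * smax2 / (smin2 * eta ^+ 2).
have se0 : 0 < smin2 * eta ^+ 2 by rewrite mulr_gt0.
have cE : c * (smin2 * eta ^+ 2) = s%:R * rho * smax2 by rewrite divfK// gt_eqF.
have sr0 : 0 < s%:R * rho by rewrite mulr_gt0// (lt_le_trans ltr01).
have c_ge : s%:R * rho <= c * eta ^+ 2.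
  by rewrite -(ler_pM2r smin0) -(mulrA c) [eta ^+ 2 * _]mulrC cE ler_pM2l.
have c1 : 1 <= c.
  by rewrite -(ler_pM2r eta2) mul1r (le_trans _ c_ge)//; nra.
have l0 : 0 < ln (2 * n%:R) :> R.
  by apply: ln_gt0; have : 1 <= n%:R :> R by [rewrite ler1n]; lra.
(* Using only [pi e >= 4] and [gamma^-2 >= 1], the constant is at least [18 * 2^9 * 4 = 36864],
   which exceeds [47 * 769 = 36143]. *)
have mc : 47 * (769 * (c * ln (2 * n%:R))) <= m%:R.
  have /andP[g0 g1] := g01.
  apply: le_trans mlow; set l := ln _ in l0 *.
  have -> : (18 * 2 ^+ 9 * pi * expR 1) / eta ^+ 2
      * (rho * (smax2 / smin2) / gamma ^+ 2) * s%:R * l =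
      18 * 2 ^+ 9 * (pi * expR 1 * (gamma ^+ 2)^-1) * (c * l).
    by rewrite /c; field; rewrite !gt_eqF.
  have e2 : 2 <= expR 1 :> R by have := expR_ge1Dx (1 : R); lra.
  have epi : 4 <= pi * expR 1 :> R by have := pi_ge2 R; nra.
  have gi : 1 <= (gamma ^+ 2)^-1.
    by rewrite invf_ge1 ?exprn_gt0// expr_le1// ltW.
  have cl0 : 0 <= c * l by rewrite mulr_ge0 ?(ltW l0)// (le_trans _ c1).
  have epg : 4 <= pi * expR 1 * (gamma ^+ 2)^-1 by nra.
  rewrite [leLHS]mulrA ler_wpM2r//.
  have : 18 * 2 ^+ 9 * 4 <= 18 * 2 ^+ 9 * (pi * expR 1 * (gamma ^+ 2)^-1).
    by rewrite ler_wpM2l// mulr_ge0// exprn_ge0.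
  lra.
have m0 : 0 < m%:R :> R.
  have c0 : 0 < c by exact: lt_le_trans c1.
  have cl0 : 0 < c * ln (2 * n%:R) by exact: mulr_gt0.
  lra.
(* [768 = 32 * 4 * 6]: the 32 of [NSP_of_net], the 4 of the upper tail and the 6 of the lower tail.
   Rounding up costs at most 1, hence at most [c]. *)
have [k /andP[k_ge k_le]] : exists k : nat, 768 * c <= k%:R <= 768 * c + 1.
  by apply: exists_natr_between; lra.
have {}k_le : k%:R <= 769 * c by lra.
pose q (v : 'cV[R]_d) := (v^T *m Sigma *m v) 0 0.
(* For a zero vector the inequality would read [0 <= 0] and hold everywhere, so the bad event is set
   to be empty there; the same goes for [low]. *)
pose up (i : 'I_n) := if col i D == 0 then set0 else
  [set w | 4 * m%:R * q (col i D) <= sqnorm (rand_mx X w *m col i D)].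
pose low (t : k.-tuple ('I_n * bool)) := if D *m net_point t == 0 then set0 else
  [set w | sqnorm (rand_mx X w *m (D *m net_point t))
             <= m%:R / 6 * q (D *m net_point t)].
have mup i : measurable (up i).
  rewrite /up; case: ifP => // _; rewrite -[X in measurable X]setTI.
  by apply: measurable_fun_le => //; exact: measurable_sqnorm_rand_mx.
have mlow' t : measurable (low t).
  rewrite /low; case: ifP => // _; rewrite -[X in measurable X]setTI.
  by apply: measurable_fun_le => //; exact: measurable_sqnorm_rand_mx.
have Pup i : (P (up i) <= (expR (- (m%:R / 2)))%:E)%E.
  rewrite /up; have [_|v0] := eqVneq (col i D) 0.
    by rewrite measure0 lee_fin expR_ge0.
  exact: (gaussian_upper_tail mX indX gaussX posS v0).
have Plow t : (P (low t) <= (expR (- (m%:R / 4)))%:E)%E.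
  rewrite /low; have [_|v0] := eqVneq (D *m net_point t) 0.
    by rewrite measure0 lee_fin expR_ge0.
  exact: (gaussian_lower_tail mX indX gaussX posS v0).
pose U := (\big[setU/set0]_i up i) `|` (\big[setU/set0]_t low t).
have mU1 : measurable (\big[setU/set0]_i up i) by exact: bigsetU_measurable.
have mU2 : measurable (\big[setU/set0]_t low t) by exact: bigsetU_measurable.
have mU : measurable U by exact: measurableU.
(* The good event avoids finitely many measurable bad events, so it is measurable whatever the set
   of [w] with the null space property is. *)
exists (~` U); split; first exact: measurableC.
split.
  move=> w /= Uw.
  have nup i : ~ up i w by move=> uw; apply: Uw; left; exact: (@sub_bigsetU _ _ up i w).
  have nlow t : ~ low t w by move=> lw; apply: Uw; right; exact: (@sub_bigsetU _ _ low t w).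
  (* The tail levels [4 m q] and [m q / 6] become these [a] and [b] through
     [smin2 |v|^2 <= q v <= smax2 |v|^2]. *)
  apply: (@NSP_of_net _ _ _ _ _ k gamma eta rho (4 * m%:R * smax2 * rho)
    (m%:R / 6 * smin2)) => //.
  - by rewrite !mulr_gt0.
  - by rewrite mulr_ge0 ?divr_ge0// ltW.
  - move=> i; have := nup i; rewrite /up.
    have [-> _|v0 /negP] := eqVneq (col i D) 0.
      by rewrite mulmx0 sqnorm0 !mulr_ge0// ltW.
    rewrite -ltNge => /ltW/le_trans; apply.
    rewrite -(mulrA (4 * m%:R)) ler_wpM2l ?mulr_ge0//.
    have /andP[_ /le_trans] := form (col i D); apply.
    by rewrite ler_wpM2l// ltW.
  - move=> t /negbTE v0; have := nlow t; rewrite /low v0 => /negP.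
    rewrite -ltNge; apply: le_lt_trans.
    rewrite -(mulrA (m%:R / 6)) ler_wpM2l ?divr_ge0//.
    by have /andP[] := form (D *m net_point t).
  - have := ler_wpM2r (ltW eta2) k_ge; nra.
  (* Multiplied by [m / 6], this is exactly the required [32 s a <= b k eta^2]. *)
  - have h : 768 * (s%:R * rho * smax2) <= k%:R * (smin2 * eta ^+ 2).
      by rewrite -cE mulrA ler_wpM2r// ltW.
    have := ler_wpM2l (ltW m0) h; lra.
rewrite probability_setC// EFinB leeB//.
have : (P U <= (n%:R * expR (- (m%:R / 2))
    + (2 * n%:R) ^+ k * expR (- (m%:R / 4)))%:E)%E.
  apply: (le_trans (measureU2 _ mU1 mU2)); rewrite EFinD leeD//.
    by have := union_bound mup Pup; rewrite card_ord.
  have card_net : #|{: k.-tuple ('I_n * bool)}|%:R = (2 * n%:R) ^+ k :> R.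
    by rewrite card_tuple card_prod card_ord card_bool natrX natrM mulrC.
  by have := union_bound mlow' Plow; rewrite card_net.
move=> /le_trans; apply; rewrite lee_fin.
exact: (failure_bound n0 c1 k_le mc).
Qed.
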